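(* Let $I=(i_1,\dots,i_n)$ be a list of closed intervals of the real line sorted by right endpoint, let $G(I)$ be its interval graph and $S\subseteq I$. The Steiner cycle algorithm described in the context correctly decides whether $G(I)$ has a Steiner cycle (a cycle containing every interval of $S$), and if one exists it outputs such a cycle.
   Context: For an interval $i=[x,y]$ write $\operatorname{l}(i)=x$, $\operatorname{r}(i)=y$. $G(I)$ has the intervals as vertices, adjacent iff they intersect. A path is a list of pairwise distinct vertices with consecutive ones adjacent; it is a cycle if moreover its last and first vertices are adjacent. $\operatorname{end}(P)$ is the last vertex of $P$, $\operatorname{rev}(P)$ the reversed list, and $(P,Q)$, $(P,i)$ denote concatenation. Algorithm $\mathbf{GP}_S$ on a right-endpoint-sorted list $J$: start with $P=$ (first interval of $J$); repeatedly let $i'$ be the interval of $J$ adjacent to $\operatorname{end}(P)$, not in $P$ and not previously neglected, with minimum right endpoint; if $i'\notin S$ and $\operatorname{r}(i')<\operatorname{r}(\operatorname{end}(P))$, mark $i'$ neglected (never used afterwards) and consider the next candidate; otherwise extend $P$ by $i'$. Stop when no candidate remains. Iterated $\mathbf{GP}_S$: repeatedly apply $\mathbf{GP}_S$ to $(i_j,\dots,i_n)$, where $j$ is the smallest index with $i_j\in S$ not yet on a computed path, until all of $S$ is covered; this yields a minimum Steiner path cover. Steiner cycle algorithm: run iterated $\mathbf{GP}_S$. If it produces more than one path, report that no Steiner cycle exists. Otherwise let $P=(p_1,\dots,p_l)$ be the produced Steiner path. Set $R=(p_1)$, $Q=(p_2)$. For $j=3,\dots,l$: if $\operatorname{end}(Q)=p_{j-1}$,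 append $p_j$ to $R$ if $p_j\cap\operatorname{end}(R)\neq\emptyset$ and to $Q$ otherwise; if $\operatorname{end}(R)=p_{j-1}$, append $p_j$ to $Q$ if $p_j\cap\operatorname{end}(Q)\neq\emptyset$ and to $R$ otherwise. Finally, if $\operatorname{end}(Q)\cap\operatorname{end}(R)\neq\emptyset$, output the cycle $(Q,\operatorname{rev}(R))$; else if there is an interval $i'\in I\setminus P$ with $\operatorname{r}(i')>\operatorname{r}(p)$ for all $p\in P$ such that $i'\cap\operatorname{end}(Q)\neq\emptyset$ and $i'\cap\operatorname{end}(R)\neq\emptyset$, output the cycle $(Q,i',\operatorname{rev}(R))$; otherwise report that no Steiner cycle exists.
   Formalization: The path P from iterated GP_S is cut off once all of S is covered (with the full run the algorithm can miss a cycle); equal right endpoints are compared by list position; when S has at most one interval, where p_2 is undefined, the algorithm outputs the list of S. *)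

(* Defs.v *)
From mathcomp Require Import all_boot all_order all_algebra.
From mathcomp Require Import reals.

Set Implicit Arguments.
Unset Strict Implicit.
Unset Printing Implicit Defensive.

Import Order.TTheory GRing.Theory Num.Theory.
Local Open Scope ring_scope.

Record cinterval (R : realType) := CInterval {
  lft : R;
  rgt : R;
  lft_le_rgt : lft <= rgt
}.

Definition intersects (R : realType) (i j : cinterval R) : bool :=
  (lft i <= rgt j) && (lft j <= rgt i).

Lemma intersectsP (R : realType) (i j : cinterval R) :
  reflect (exists2 x, x \in `[lft i, rgt i] & x \in `[lft j, rgt j])
          (intersects i j).
Proof.
apply: (iffP andP) => [[ij ji]|[x]]; last first.
  rewrite !in_itv /= => /andP[ix xi] /andP[jx xj].
  by split; [apply: le_trans xj|apply: le_trans xi].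
have [ll|/ltW ll] := leP (lft i) (lft j).
  by exists (lft j); rewrite in_itv /= ?ll ?ji ?lexx ?lft_le_rgt.
by exists (lft i); rewrite in_itv /= ?ll ?ij ?lexx ?lft_le_rgt.
Qed.

(* The vertices of the interval graph are the positions 'I_n of the list, so
   that equal intervals at different positions are different vertices. *)
Section Algorithm.
Variables (R : realType) (n : nat) (I : n.-tuple (cinterval R)).
Implicit Types (u v w x : 'I_n) (S : {set 'I_n}) (J P Q C : seq 'I_n).

(* Reflexive; as paths have distinct vertices, this only matters for lists
   with a single vertex, which count as cycles. *)
Definition adj u v : bool := intersects (tnth I u) (tnth I v).

(* ucycle is the library's notion: distinct vertices, consecutive ones
   adjacent, and the last adjacent to the first. *)
Definition is_steiner_cycle S C : Prop := ucycle adj C /\ {subset S <= C}.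

(* The order of right endpoints, with ties broken by the position in the list:
   with a strict comparison of the values alone, the last step of the algorithm
   misses the closing interval [0, 12] in ([6, 9], [9, 11], [10, 12], [0, 12])
   when S consists of the first three intervals. *)
Definition rlt u v : bool :=
  (rgt (tnth I u) < rgt (tnth I v)) ||
  (rgt (tnth I u) == rgt (tnth I v)) && (u < v)%N.

(* A state (P, N) is the current path and the intervals neglected so far.  The
   candidates are listed in the order of J, so when J is sorted by right
   endpoint the first one has the minimum right endpoint. *)
Definition gp_step S J x (st : seq 'I_n * seq 'I_n) : seq 'I_n * seq 'I_n :=
  let: (P, N) := st in
  if [seq v <- J | adj (last x P) v && (v \notin P ++ N)] is v :: _ then
    if (v \notin S) && rlt v (last x P) then (P, v :: N) else (rcons P v, N)
  else (P, N).

(* Every step but the final idle ones moves an interval of J into P or N, hence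
   size J steps reach the state without candidates. *)
Definition gp S J : seq 'I_n :=
  if J is x :: _ then (iter (size J) (gp_step S J x) ([:: x], [::])).1
  else [::].

Definition uncovered S (Ps : seq (seq 'I_n)) : seq 'I_n :=
  [seq v <- enum 'I_n | (v \in S) && (v \notin flatten Ps)].

(* The shortest initial part of P containing T, or P if there is none. *)
Definition until_covered (T P : seq 'I_n) : seq 'I_n :=
  take (find (fun k => all (mem (take k P)) T) (iota 0 (size P))) P.

(* The procedure stops as soon as S is covered, so the last path ends with its
   last interval of S.  If the last path were extended until no candidate
   remains, then no interval of larger right endpoint could ever be left to
   close the cycle, and for S the first three intervals of
   ([0, 10], [5, 20], [6, 25], [22, 40]) the cycle algorithm below would miss
   the triangle S. *)
Definition iterated_gp_step S (Ps : seq (seq 'I_n)) : seq (seq 'I_n) :=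
  if uncovered S Ps is v :: _ then
    rcons Ps (until_covered (uncovered S Ps) (gp S (drop v (enum 'I_n))))
  else Ps.

Definition iterated_gp S : seq (seq 'I_n) := iter n (iterated_gp_step S) [::].

(* split_path p1 p2 prev s R Q distributes the intervals s = (p_j, ..., p_l) over R
   and Q, with prev = p_(j-1), which is the end of either Q or R; p1 and p2 are
   the first intervals of R and Q. *)
Fixpoint split_path p1 p2 prev (s R Q : seq 'I_n) : seq 'I_n * seq 'I_n :=
  if s is p :: s' then
    if last p2 Q == prev then
      if adj p (last p1 R) then split_path p1 p2 p s' (rcons R p) Q
      else split_path p1 p2 p s' R (rcons Q p)
    else
      if adj p (last p2 Q) then split_path p1 p2 p s' R (rcons Q p)
      else split_path p1 p2 p s' (rcons R p) Q
  else (R, Q).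

(* None reports that there is no Steiner cycle.  When S has at most one
   element there is no p_2 (or no path at all); the output is then the list of
   the elements of S. *)
Definition steiner_cycle_algorithm S : option (seq 'I_n) :=
  match iterated_gp S with
  | [::] => Some [::]
  | [:: P] =>
      if P is p1 :: p2 :: s then
        let: (R, Q) := split_path p1 p2 p2 s [:: p1] [:: p2] in
        if adj (last p2 Q) (last p1 R) then Some (Q ++ rev R)
        else if [pick v | [&& v \notin P, all (fun p => rlt p v) P,
                              adj v (last p2 Q) & adj v (last p1 R)]] is Some v
        then Some (Q ++ v :: rev R)
        else None
      else Some P
  | _ => None
  end.

End Algorithm.

(* Main.v *)
(* As the list is sorted by right endpoint, the graph enters the proof only
   through the umbrella property of positions: if u <= v <= w and u, w are
   adjacent, then so are v, w.

   A Steiner cycle is excluded by an obstruction: a set X of vertices whose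
   removal leaves more than |X| (and at least two) elements of S in pairwise
   different components.  By the umbrella property it suffices to separate the
   elements E of S by thresholds T such that every vertex beyond some t in T and
   adjacent to t lies in X.

   A greedy path p_0, p_1, ... provides at each time i an obstruction with
   |E| = |X| + 1 on the vertices visited so far.  If p_j is the last vertex
   before time i lying beyond p_i, then X is obtained from the one at time j - 1
   by adding p_j, T by adding p_i, and E by adding p_(j+1), which is in S because
   the path goes down there.  One more element of S beyond p_i then completes the
   obstruction when the greedy path is stuck, or when the only way out of p_i is
   a single vertex, which is added to X.  If the two ends of the split paths
   cannot be joined, the latter happens at the end that has stalled, or else at
   the predecessor of the maximum of the path. *)
Require Import Defs.
From mathcomp Require Import all_boot all_order all_algebra.
From mathcomp Require Import reals zify.

Set Implicit Arguments.
Unset Strict Implicit.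
Unset Printing Implicit Defensive.

(** * Obstructions to cycles, from the umbrella property alone *)

Section Obstruction.
Variables (n : nat) (e : rel 'I_n).
Hypothesis e_sym : symmetric e.
Hypothesis e_umbrella :
  forall u v w : 'I_n, u <= v -> v <= w -> e u w -> e v w.
Implicit Types (t u v w x y z : 'I_n) (X T E C : seq 'I_n) (S : {set 'I_n}).

Definition separates X T := forall t y, t \in T -> t < y -> e t y -> y \in X.

(** The thresholds cut the vertex order into slices; this numbers the slice of [v]. *)
Definition block T v := count (fun t : 'I_n => t < v) T.

(** If a threshold [t] satisfies [u <= t < v] for an edge [u v], the umbrella property gives the
    edge [t v], so [v] is in [X]. *)
Lemma block_adj X T u v :
  separates X T -> u \notin X -> v \notin X -> e u v -> block T u = block T v.
Proof.
move=> sepXT; wlog le_uv : u v / u <= v => [wl uX vX uv|uX vX uv].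
  by case/orP: (leq_total u v) => le; [|apply/esym]; apply: wl => //;
    rewrite e_sym.
apply: eq_in_count => t tT; apply/idP/idP => [|lt_tv]; first by lia.
rewrite ltnNge; apply/negP => le_ut; case/negP: vX.
by apply: (sepXT t) => //; apply: (e_umbrella le_ut) => //; lia.
Qed.

Lemma block_inj T E :
  (forall u v, u \in E -> v \in E -> u < v ->
    exists2 t, t \in T & u <= t < v) ->
  {in E &, injective (block T)}.
Proof.
move=> sepE u v; wlog lt_uv : u v / u < v => [wl uE vE buv|uE vE].
  by case: (ltngtP u v) => [||/val_inj//] lt; [|apply/esym]; apply: wl.
have [t tT /andP[le_ut lt_tv]] := sepE _ _ uE vE lt_uv.
suff: block T u < block T v by move=> + buv; rewrite buv ltnn.
(* Splitting [T] at [t] isolates the one threshold that counts for [v] but not for [u]. *)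
rewrite /block -(cat_take_drop (index t T) T) (drop_nth t) ?index_mem //.
rewrite nth_index // !count_cat /= lt_tv (leq_gtF le_ut) add0n addnCA ltnS.
by apply: leq_add; apply: sub_count => w /= lt_wu; apply: ltn_trans lt_uv.
Qed.

Lemma path_block X T c p u :
    separates X T -> path e c p -> all [predC X] (c :: p) -> u \in c :: p ->
  block T u = block T c.
Proof.
move=> sepXT; elim: p c => [|d p IHp] c;
  first by rewrite mem_seq1 => _ _ /eqP->.
move=> /= /andP[cd dp] /and3P[cX dX pX]; rewrite inE => /predU1P[->//|ud].
rewrite (block_adj sepXT cX dX cd); apply: IHp => //=.
by rewrite pX andbT.
Qed.

(* Along a path, a vertex of E can only be followed by another one after X has
   been met; the extra unit accounts for the first E-vertex met from c. *)
Lemma count_path X T E c p :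
    separates X T -> {in E &, injective (block T)} ->
    {in E, forall u, u \notin X} -> path e c p -> uniq p ->
  count [in E] p <= count [in X] p +
    ((c \in X) || has (fun u => (u \in E) && (block T u == block T c)) p).
Proof.
move=> sepXT injE EX;
  elim: p c => [|d p IHp] c //= /andP[cd dp] /andP[dNp uniq_p].
have {IHp} := IHp d dp uniq_p.
have [dX|dX] := boolP (d \in X).
  have -> : d \in E = false by apply/negP => /EX; rewrite dX.
  by rewrite /= add0n addn1 add1n => /leq_trans; apply; apply: leq_addr.
have [cX|cX] := boolP (c \in X);
  last rewrite (block_adj sepXT cX dX cd) eqxx andbT;
  rewrite !add0n /=; (have [dE|dE] := boolP (d \in E)).
- case: hasP => [[u up /andP[uE /eqP/injE du]]|_]; last by rewrite addn0 addn1.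
  by rewrite -(du uE dE) up in dNp.
- by move/leq_trans; apply; rewrite leq_add2l leq_b1.
- case: hasP => [[u up /andP[uE /eqP/injE du]]|_]; last by rewrite addn0 addn1.
  by rewrite -(du uE dE) up in dNp.
- by [].
Qed.

(** A cycle avoiding [X] stays in one block and meets [E] at most once; otherwise at most one
    element of [E] follows each visit to [X]. *)
Lemma obstruction_small X T E C :
    separates X T -> uniq E -> {in E, forall u, u \notin X} ->
    (forall u v, u \in E -> v \in E -> u < v ->
      exists2 t, t \in T & u <= t < v) ->
    ucycle e C -> {subset E <= C} ->
  (size E <= size X) || (size E <= 1).
Proof.
move=> sepXT uniqE EX /block_inj injE /andP[cycC uniqC] EC.
have leE : size E <= count [in E] C.
  by rewrite -size_filter; apply: uniq_leq_size => // u uE;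
    rewrite mem_filter /= uE EC.
have leX : count [in X] C <= size X.
  rewrite -size_filter; apply: uniq_leq_size; first exact: filter_uniq.
  by move=> u; rewrite mem_filter => /andP[].
have [/hasP[x xC xX]|noX] := boolP (has [in X] C); last first.
  apply/orP; right; case: C => [|c p] in cycC noX EC {leE leX uniqC}.
    by case: E EC {uniqE EX injE} => // u E /(_ u);
      rewrite mem_head => /(_ isT).
  move: cycC; rewrite /= rcons_path => /andP[cp _].
  have bE u : u \in E -> block T u = block T c.
    by move=> /EC; apply: (path_block sepXT cp); rewrite all_predC.
  case: E uniqE injE bE {EX EC} => [|u [|v E]] //= /andP[uN _] injE bE.
  have/injE : block T u = block T v by rewrite !bE ?inE ?eqxx ?orbT.
  by rewrite !inE !eqxx ?orbT => /(_ isT isT) uv; rewrite uv !inE eqxx in uN.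
apply/orP; left; apply: (leq_trans leE); apply: leq_trans leX.
(* Started at a vertex of [X], the cycle itself pays for the extra unit in [count_path]. *)
have [i p rotC] := rot_to xC.
have pE q : count q C = count q (x :: p) by rewrite -rotC; apply/permP;
  rewrite perm_sym perm_rot.
have : cycle e (x :: p) && uniq (x :: p)
  by rewrite -rotC rot_cycle rot_uniq cycC.
rewrite /= rcons_path => /andP[/andP[xp _] /andP[_ up]].
have := count_path sepXT injE EX xp up.
rewrite !pE /= xX /=.
have -> : x \in E = false by apply/negP => /EX; rewrite xX.
by lia.
Qed.


(** * Greedy paths and the obstructions on their prefixes *)

(** The values of [p] beyond [l] are arbitrary. Both [greedy_next] and [greedy_new] reflect the
    choice of the smallest candidate; [greedy_new] asks for [p m < u] because neglected vertices
    always lie below the current end. *)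
Record greedy S (p : nat -> 'I_n) (l : nat) : Prop := Greedy {
  greedy_inj : forall k m, k <= l -> m <= l -> p k = p m -> k = m;
  greedy_adj : forall m, m < l -> e (p m) (p m.+1);
  greedy_min : forall m, m <= l -> p 0 <= p m;
  greedy_start : p 0 \in S;
  greedy_back : forall m k, m < k -> k <= l -> p k < p m -> e (p k) (p m);
  greedy_next : forall m k, m < k -> k <= l -> e (p m) (p k) -> p m.+1 <= p k;
  greedy_new : forall m u, m < l -> p m < u -> (forall k, k <= m -> p k <> u) ->
    e (p m) u -> p m.+1 <= u;
  greedy_down : forall m, m < l -> p m.+1 < p m -> p m.+1 \in S }.

(** By [obs_cut] the only exits not blocked by [X] lead to unvisited vertices beyond [p i]; by the
    umbrella property they are exits of [p i] itself. *)
Record prefix_obstruction S (p : nat -> 'I_n) i X T E : Prop :=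
  PrefixObstruction {
  obs_size : size E = (size X).+1;
  obs_uniq : uniq E;
  obs_sub : {in E, forall u, u \in S};
  obs_notin : {in E, forall u, u \notin X};
  obs_le : {in E, forall u, u <= p i};
  obs_end : p i \in T;
  obs_T : {in T, forall t, t <= p i};
  obs_X : {in X, forall x, exists2 k, k <= i & p k = x};
  obs_sep : forall u v, u \in E -> v \in E -> u < v ->
    exists2 t, t \in T & u <= t < v;
  obs_cut : forall t y, t \in T -> t < y -> e t y ->
    y \in X \/ p i < y /\ forall k, k <= i -> p k <> y }.

Lemma greedy_obstruction S p l i :
  greedy S p l -> i <= l -> exists X T E, prefix_obstruction S p i X T E.
Proof.
move=> gr; elim/ltn_ind: i => i IHi le_il.
have [/existsP[j0 lt_j0]|none] := boolP [exists j : 'I_i, p i < p j];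
  last first.
  exists [::], [:: p i], [:: p 0]; split => //.
  - by move=> u; rewrite inE => /eqP->; apply: greedy_start gr.
  - by move=> u; rewrite inE => /eqP->; apply: greedy_min gr _ _.
  - by rewrite inE.
  - by move=> t; rewrite inE => /eqP->.
  - by move=> u v; rewrite !inE => /eqP-> /eqP->; rewrite ltnn.
  move=> t y; rewrite inE => /eqP-> lt_y _; right; split=> // k le_ki pk.
  move: le_ki; rewrite leq_eqVlt => /predU1P[ki|lt_ki].
    by rewrite -pk ki ltnn in lt_y.
  by case/existsP: none; exists (Ordinal lt_ki); rewrite /= pk.
have exj : exists j, (j < i) && (p i < p j) by exists j0; rewrite ltn_ord.
have ubj j : (j < i) && (p i < p j) -> j <= i by case/andP=> /ltnW.
case: (ex_maxnP exj ubj) => j /andP[lt_ji lt_pij] max_j {j0 lt_j0 exj ubj}.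
have after k : j < k -> k <= i -> p k <= p i.
  move=> lt_jk le_ki; rewrite leqNgt; apply/negP => lt_ik.
  have ne_ki : k != i by apply: contraTneq lt_ik => ->; rewrite ltnn.
  by have := max_j k; rewrite lt_ik ltn_neqAle ne_ki le_ki => /(_ isT); lia.
(* The start is the minimum of the path, so the last vertex beyond [p i] has a predecessor. From
   here on that vertex is [p j.+1], and the induction is applied at [j]. *)
case: j => [|j] in lt_ji lt_pij max_j after *.
  by have := greedy_min gr le_il; lia.
(* Were [p i] below [p j], it would be adjacent to [p j] and preferred to [p j.+1]. *)
have lt_ji1 : p j < p i.
  rewrite ltnNge leq_eqVlt; apply/negP => /predU1P[/val_inj eq_ij|lt_ij].
    by have := greedy_inj gr _ _ eq_ij; lia.
  by have := greedy_next gr _ _ (_ : e (p j) (p i));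
    rewrite e_sym (greedy_back gr _ _ lt_ij); lia.
have down : p j.+2 < p j.+1 by have := after j.+2; lia.
(* For the same reason the path stays above [p j] from now on, so [p j] separates the old elements
   of [E] from the new one. *)
have beyond k : j < k -> k <= l -> p j < p k.
  move=> lt_jk le_kl; rewrite ltnNge leq_eqVlt; apply/negP.
  case/predU1P => [/val_inj eq_kj|lt_kj].
    by have := greedy_inj gr _ _ eq_kj; lia.
  have := greedy_next gr lt_jk le_kl.
  by rewrite e_sym (greedy_back gr _ _ lt_kj) //; lia.
have [||X [T [E obs]]] := IHi j; [lia|lia|].
have newX y : p i < y -> (forall k, k <= j -> p k <> y) -> y <> p j.+1 ->
    forall k, k <= i -> p k <> y.
  move=> lt_iy new ne k le_ki eq_ky; case: (ltngtP k j.+1) => [|lt_jk|eq_k].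
  - by rewrite ltnS => /new.
  - by have := after k lt_jk le_ki; rewrite eq_ky; lia.
  - by apply: ne; rewrite -eq_ky eq_k.
exists (p j.+1 :: X), (p i :: T), (p j.+2 :: E); split.
- by rewrite /= (obs_size obs).
- rewrite /= (obs_uniq obs) andbT; apply/negP => /(obs_le obs).
  by rewrite leqNgt beyond //; lia.
- move=> u; rewrite inE => /predU1P[->|/(obs_sub obs)//].
  by apply: greedy_down gr _ _ _ => //; lia.
- move=> u; rewrite !inE => /predU1P[->|uE].
    rewrite negb_or; apply/andP; split.
      by apply: contraTneq down => ->; rewrite ltnn.
    apply/negP => /(obs_X obs)[k le_kj eq_k].
    by have := greedy_inj gr _ _ eq_k; lia.
  rewrite negb_or (obs_notin obs uE) andbT.
  apply: contraTneq (obs_le obs uE) => ->.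
  by rewrite -ltnNge beyond //; lia.
- move=> u; rewrite inE => /predU1P[->|/(obs_le obs)]; last by lia.
  by apply: after; lia.
- exact: mem_head.
- by move=> t; rewrite inE => /predU1P[->//|/(obs_T obs)]; lia.
- move=> x; rewrite inE => /predU1P[->|/(obs_X obs)[k le_kj <-]].
    by exists j.+1 => //; lia.
  by exists k => //; lia.
- move=> u v; rewrite !inE => /predU1P[->|uE] /predU1P[->|vE] lt_uv.
  + by lia.
  + by have := obs_le obs vE; have := beyond j.+2; lia.
  + exists (p j); first by rewrite inE (obs_end obs) orbT.
    by rewrite (obs_le obs uE) beyond //; lia.
  + have [t tT tuv] := obs_sep obs uE vE lt_uv.
    by exists t; rewrite // inE tT orbT.
move=> t y; rewrite !inE => /predU1P[->|tT] lt_ty ty.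
  have [->|ne_y] := eqVneq y (p j.+1); first by left.
  have [/existsP[k /eqP eq_k]|new] := boolP [exists k : 'I_j.+1, p k == y];
    last first.
    right; split=> //; apply: newX => //.
      by move=> k le_kj eq_k; case/existsP: new;
        exists (Ordinal (le_kj : k < j.+1)); apply/eqP.
    exact/eqP.
  (* An earlier vertex beyond [p i] is also beyond [p j], hence adjacent to it and already in the
     old [X]. *)
  left=> /=; have lt_kj : k < j.
    rewrite ltn_neqAle -ltnS ltn_ord andbT; apply/eqP => eq_kj.
    by rewrite -eq_k eq_kj in lt_ty; lia.
  have jy : e (p j) y.
    by rewrite -eq_k; apply: greedy_back gr _ _ _ _ _; rewrite ?eq_k; lia.
  case: (obs_cut obs (obs_end obs) _ jy) => // [|[_ new]]; first by lia.
  by case: (new k _ eq_k); lia.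
case: (obs_cut obs tT lt_ty ty) => [yX|[lt_jy new]]; first by left;
  rewrite yX orbT.
(* An open exit from an old threshold is one from [p j]; the greedy choice puts it at or above
   [p j.+1], which is beyond [p i]. *)
have jy : e (p j) y by apply: e_umbrella ty; [exact: obs_T obs _ tT|lia].
have [->|ne_y] := eqVneq y (p j.+1); first by left.
have le_y : p j.+1 <= y by apply: greedy_new gr _ _ _ lt_jy new jy; lia.
right; split; first by lia.
by apply: newX => //; [lia|exact/eqP].
Qed.

(** Adding [z] makes [size X + 2] separated elements of [S], while [X1 ++ X] has at most
    [size X + 1] vertices. *)
Lemma prefix_obstruction_no_cycle S p i X T E (X1 : seq 'I_n) z C :
    prefix_obstruction S p i X T E -> z \in S -> p i < z ->
    (forall k, k <= i -> p k <> z) ->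
    size X1 <= 1 -> z \notin X1 -> {in X1, forall x, p i < x} ->
    (forall y, p i < y -> (forall k, k <= i -> p k <> y) -> e (p i) y ->
      y \in X1) ->
  ucycle e C -> ~ {subset S <= C}.
Proof.
move=> obs zS lt_iz newz sX1 zX1 X1gt cover cycC SC.
have: (size (z :: E) <= size (X1 ++ X)) || (size (z :: E) <= 1).
  apply: (@obstruction_small _ T _ C) => //.
  - move=> t y tT lt_ty ty; rewrite mem_cat.
    case: (obs_cut obs tT lt_ty ty) => [->|[lt_iy new]]; first by rewrite orbT.
    by rewrite cover // (e_umbrella _ _ ty) ?(obs_T obs) //; lia.
  - rewrite /= (obs_uniq obs) andbT; apply/negP => /(obs_le obs).
    by rewrite leqNgt lt_iz.
  - move=> u; rewrite inE mem_cat negb_or => /predU1P[->|uE].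
      by rewrite zX1; apply/negP => /(obs_X obs)[k /newz].
    rewrite (obs_notin obs uE) andbT; apply/negP => /X1gt.
    by rewrite ltnNge (obs_le obs uE).
  - move=> u v; rewrite !inE => /predU1P[->|uE] /predU1P[->|vE] lt_uv.
    + by rewrite ltnn in lt_uv.
    + by have := obs_le obs vE; lia.
    + by exists (p i); rewrite ?(obs_end obs) ?(obs_le obs).
    + exact: obs_sep obs _ _ uE vE lt_uv.
  - by move=> u; rewrite inE => /predU1P[->|/(obs_sub obs)]; apply: SC.
by rewrite size_cat /= (obs_size obs); lia.
Qed.

(** Here [p i] and [p l] are the two ends that cannot be joined. In both cases [p l] is the
    additional element of [S], and the single exit is the next vertex of the path. *)
Lemma greedy_stalled_no_cycle S p l i C :
    greedy S p l -> p l \in S -> i.+1 < l ->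
    (forall k, i.+1 < k -> k <= l -> ~~ e (p k) (p i)) ->
    (forall v, (forall k, k <= l -> p k < v) -> e v (p i) -> ~~ e v (p l)) ->
  ucycle e C -> ~ {subset S <= C}.
Proof.
move=> gr plS lt_il stalled open_ends cycC.
have inj k m : k <= l -> m <= l -> k <> m -> p k <> p m.
  by move=> lekl leml ne /(greedy_inj gr lekl leml).
have beyond k : i < k -> k <= l -> p i < p k.
  move=> lt_ik le_kl; case: (ltngtP (p i) (p k)) => // [lt_ki|/val_inj];
    last first.
    by move/inj; lia.
  case: (ltngtP i.+1 k) => [lt_i1k||eq_k]; [|by lia|].
    by have := stalled k lt_i1k le_kl; rewrite (greedy_back gr).
  (* A descent right after [p i] would make [p i.+2] adjacent to [p i], by the umbrella property or,
     if [p i.+2] is below [p i], by [greedy_back]. *)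
  subst k; have := stalled i.+2 (ltnSn _) lt_il.
  have adj2 := greedy_adj gr (lt_il : i.+1 < l).
  rewrite e_sym (e_umbrella (ltnW lt_ki) _ adj2) //.
  case: (leqP (p i) (p i.+2)) => // lt_2i.
  by have := stalled i.+2 (ltnSn _) lt_il;
    rewrite (greedy_back gr _ _ lt_2i) //; lia.
have [k _ max_k] := @arg_maxnP 'I_l.+1 ord0 xpredT (fun k => p k) isT.
have {}max_k m : m <= l -> p m <= p k by move=> le_ml;
  apply: (max_k (Ordinal (le_ml : m < l.+1))).
have := leq_ord k; move: (nat_of_ord k) max_k => {}k max_k le_kl.
(* By the umbrella property, such an edge would make [y] a common neighbour of both ends beyond the
   whole path. *)
have closing m y : m <= i -> p m < y -> p m <= p i -> p m <= p l -> p k < y ->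
    ~~ e (p m) y.
  move=> le_mi lt_my le_pmi le_pml lt_ky; apply/negP => my.
  have lt_y q : q <= l -> p q < y by move/max_k; lia.
  have iy : e (p i) y by apply: e_umbrella le_pmi (ltnW (lt_y _ _)) my; lia.
  have ly : e (p l) y by apply: e_umbrella le_pml (ltnW (lt_y _ _)) my.
  by have := open_ends y lt_y; rewrite ![e y _]e_sym iy ly => /(_ isT).
have [le_ki|lt_ik] := leqP k i.
  have {le_ki} lt_ki : k < i.
    rewrite ltn_neqAle le_ki andbT; apply/eqP => eq_ki; subst k.
    by have := beyond l; have := max_k l; lia.
  case: k => [|k] in max_k le_kl closing lt_ki *.
    have := max_k l (leqnn l); have := greedy_min gr (leqnn l) => le0 le1.
    by case: (inj 0 l); [lia|lia|lia|apply/val_inj/eqP; rewrite eqn_leq le0].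
  (* A later vertex below [p k] would have been preferred to the maximum [p k.+1]. *)
  have lt_k q : k.+1 < q -> q <= l -> p k < p q.
    move=> lt_kq le_ql; have max_q := max_k q le_ql.
    case: (ltngtP (p k) (p q)) => // [lt_qk|/val_inj/inj]; last by lia.
    have kq : e (p k) (p q) by rewrite e_sym (greedy_back gr _ _ lt_qk); lia.
    have le1 : p k.+1 <= p q by apply: greedy_next gr _ _ _ _ kq; lia.
    by case: (inj k.+1 q); [lia|lia|lia|apply/val_inj/eqP; rewrite eqn_leq le1].
  have [|X [T [E obs]]] := @greedy_obstruction S p l k gr; first by lia.
  apply: (prefix_obstruction_no_cycle (X1 := [:: p k.+1]) obs plS) => //.
  - by apply: lt_k; lia.
  - by move=> m le_mk; apply: inj; lia.
  - by rewrite inE; apply/eqP/inj; lia.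
  - move=> x; rewrite inE => /eqP->.
    by have := max_k l (leqnn l); have := lt_k l; lia.
  move=> y lt_ky new ky; rewrite inE.
  have le_y := greedy_new gr le_kl lt_ky new ky.
  apply: contraTeq ky => ne_y; have lt_y : p k.+1 < y.
    by rewrite ltn_neqAle le_y andbT; apply: contraNneq ne_y => /val_inj->;
      rewrite eqxx.
  by apply: closing => //; try apply: ltnW; try apply: lt_k; lia.
have [|X [T [E obs]]] := @greedy_obstruction S p l i gr; first by lia.
apply: (prefix_obstruction_no_cycle (X1 := [:: p i.+1]) obs plS) => //.
- by apply: beyond; lia.
- by move=> m le_mk; apply: inj; lia.
- by rewrite inE; apply/eqP/inj; lia.
- by move=> x; rewrite inE => /eqP->; apply: beyond; lia.
move=> y lt_iy new iy; rewrite inE eq_sym; apply/negPn/negP => ne_y.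
(* By induction [y] is adjacent to every [p m] after [p i], so the greedy choice keeps [p m.+1] at
   or below [y]; equality would contradict the stall. *)
have lt_y m : i < m -> m <= l -> p m < y.
  elim/ltn_ind: m => -[//|m] IHm lt_im le_ml.
  suff le_y : p m.+1 <= y.
    rewrite ltn_neqAle le_y andbT; apply/eqP => /val_inj eq_y.
    case: (ltngtP i m) => [lt_im'||eq_m]; [|by lia|].
      by have := stalled m.+1 lt_im' le_ml; rewrite eq_y e_sym iy.
    by rewrite -eq_m in eq_y; rewrite eq_y eqxx in ne_y.
  case: (ltngtP i m) => [lt_im'||<-]; [|by lia|].
    have lt_my : p m < y by apply: IHm; lia.
    apply: (greedy_new gr) => // [q le_qm eq_q|].
      case: (leqP q i) => [/new//|lt_iq].
      by have := IHm q; rewrite eq_q; lia.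
    by apply: e_umbrella (ltnW _) (ltnW _) iy => //; apply: beyond; lia.
  by apply: (greedy_new gr) => //; lia.
have := closing i y (leqnn _) lt_iy (leqnn _); rewrite iy.
by have := beyond l; have := lt_y k; lia.
Qed.

(** * Truncating and extending greedy paths *)

(** Serves both to truncate a path and to change the default value of [nth]. *)
Lemma greedy_take S p p' l l' :
  greedy S p l -> l' <= l -> (forall k, k <= l' -> p' k = p k) ->
  greedy S p' l'.
Proof.
move=> gr le_l eqp; split.
- by move=> k m lek lem; rewrite !eqp //; apply: (greedy_inj gr); lia.
- by move=> m ltm; rewrite !eqp //; [apply: (greedy_adj gr); lia|lia].
- by move=> m lem; rewrite !eqp //; apply: (greedy_min gr); lia.
- by rewrite eqp //; apply: greedy_start gr.
- by move=> m k lt_mk lek; rewrite !eqp //; [apply: (greedy_back gr); lia|lia].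
- by move=> m k lt_mk lek; rewrite !eqp //; [apply: (greedy_next gr);
  lia|lia|lia].
- move=> m u ltm; rewrite !eqp //; [move=> lt_mu new|lia].
  apply: (greedy_new gr) => // [|k lek]; first by lia.
  by rewrite -eqp; [apply: new|lia].
- by move=> m ltm; rewrite !eqp //; [apply: (greedy_down gr); lia|lia].
Qed.

Lemma greedy_extend S p p' l :
    greedy S p l -> (forall k, k <= l -> p' k = p k) ->
    (forall k, k <= l -> p k <> p' l.+1) -> p 0 <= p' l.+1 ->
    e (p l) (p' l.+1) ->
    (forall k, k <= l -> p' l.+1 < p k -> e (p' l.+1) (p k)) ->
    (forall k, k < l -> e (p k) (p' l.+1) -> p k.+1 <= p' l.+1) ->
    (forall u, p l < u -> (forall k, k <= l -> p k <> u) -> e (p l) u ->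
      p' l.+1 <= u) ->
    (p' l.+1 < p l -> p' l.+1 \in S) ->
  greedy S p' l.+1.
Proof.
move=> gr eqp new le0 adjw backw nextw minw downw; split.
- move=> k m; rewrite leq_eqVlt ltnS => /predU1P[->|lek];
    rewrite leq_eqVlt ltnS => /predU1P[->|lem] //; rewrite ?(eqp k) ?(eqp m) //.
  + by move/esym/new.
  + by move/new.
  + exact: greedy_inj gr _ _ lek lem.
- move=> m; rewrite ltnS leq_eqVlt => /predU1P[->|ltm];
  first by rewrite (eqp l).
  by rewrite !eqp; [apply: greedy_adj gr _ _|lia|lia].
- move=> m; rewrite (eqp 0) // leq_eqVlt => /predU1P[->//|lem].
  by rewrite eqp; [apply: greedy_min gr _ _|].
- by rewrite eqp //; apply: greedy_start gr.
- move=> m k lt_mk; rewrite leq_eqVlt => /predU1P[eqk|lek]; rewrite ?eqk.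
    by rewrite (eqp m); [apply: backw|]; lia.
  by rewrite !eqp; [apply: greedy_back gr _ _ lt_mk _|lia|lia].
- move=> m k lt_mk; rewrite leq_eqVlt => /predU1P[eqk|lek]; rewrite ?eqk.
    case: (ltngtP m l) => [lt_ml||->//]; last by lia.
    by rewrite !(eqp m) ?(eqp m.+1); [apply: nextw|lia|lia].
  by rewrite !eqp; [apply: greedy_next gr _ _ lt_mk _|lia|lia|lia].
- move=> m u; rewrite ltnS leq_eqVlt => /predU1P[->|ltm]; rewrite ?(eqp l) //.
    by move=> lt_lu newu; apply: minw => // k lek; rewrite -eqp //; apply: newu.
  rewrite !eqp; [move=> lt_mu newu|lia|lia].
  by apply: (greedy_new gr ltm lt_mu) => k lek; rewrite -eqp; [apply: newu|lia].
- move=> m; rewrite ltnS leq_eqVlt => /predU1P[->|ltm];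
  first by rewrite (eqp l).
  by rewrite !eqp; [apply: greedy_down gr _ _|lia|lia].
Qed.

End Obstruction.

(** * The interval graph and the invariant of the greedy algorithm *)

Section GreedyPath.
Variables (R : realType) (n : nat) (I : n.-tuple (cinterval R)).
Hypothesis I_sorted : sorted (fun i j => (rgt i <= rgt j)%R) I.
Implicit Types (s u v w z : 'I_n) (S : {set 'I_n}) (P Q N C : seq 'I_n).

Lemma rgt_le u v : u <= v -> (rgt (tnth I u) <= rgt (tnth I v))%R.
Proof.
rewrite (tnth_nth (tnth I u) I u) (tnth_nth (tnth I u) I v) => le_uv.
apply: (sorted_leq_nth _ _ (tnth I u) I_sorted) => //.
- by move=> x y z; apply: Order.POrderTheory.le_trans.
- by rewrite inE size_tuple.
- by rewrite inE size_tuple.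
Qed.

Lemma rltE u v : rlt I u v = (u < v).
Proof.
rewrite /rlt; case: (ltnP u v) => [/ltnW/rgt_le|/rgt_le].
  by rewrite Order.POrderTheory.le_eqVlt andbT orbC => ->.
by move=> le_vu; rewrite andbF orbF Order.POrderTheory.le_gtF.
Qed.

Lemma adj_sym : symmetric (adj I).
Proof. by move=> u v; rewrite /adj /intersects andbC. Qed.

Lemma adj_refl : reflexive (adj I).
Proof. by move=> u; rewrite /adj /intersects lft_le_rgt. Qed.

(** Interval [w] starts no later than [u] ends, hence no later than [v] ends, and [v] ends no later
    than [w]. *)
Lemma adj_umbrella u v w : u <= v -> v <= w -> adj I u w -> adj I v w.
Proof.
move=> /rgt_le le_uv /rgt_le le_vw /andP[_ le_wu]; apply/andP; split.
  exact: Order.POrderTheory.le_trans (lft_le_rgt _) le_vw.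
exact: Order.POrderTheory.le_trans le_wu le_uv.
Qed.

Lemma mem_drop_enum s v : (v \in drop s (enum 'I_n)) = (s <= v).
Proof.
rewrite -(mem_map val_inj) map_drop val_enum_ord drop_iota mem_iota add0n.
by rewrite subnKC ?ltn_ord ?andbT // ltnW.
Qed.

Lemma drop_enum s : drop s (enum 'I_n) = s :: drop s.+1 (enum 'I_n).
Proof. by rewrite (drop_nth s) ?nth_ord_enum // size_enum_ord. Qed.

Lemma head_filter_enum s (a : pred 'I_n) v J :
    [seq u <- drop s (enum 'I_n) | a u] = v :: J ->
  [/\ s <= v, a v & forall u, s <= u -> a u -> v <= u].
Proof.
move=> eqJ;
  have : v \in [seq u <- drop s (enum 'I_n) | a u] by rewrite eqJ mem_head.
rewrite mem_filter mem_drop_enum => /andP[av le_sv]; split=> // u le_su au.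
have : sorted (relpre val ltn) (v :: J).
  rewrite -eqJ; apply: sorted_filter; first by move=> x y z; apply: ltn_trans.
  by apply: drop_sorted; rewrite -sorted_map val_enum_ord iota_ltn_sorted.
move=> /(order_path_min (fun x y z =>
  @ltn_trans (val x) (val y) (val z)))/allP lt_v.
have : u \in v :: J by rewrite -eqJ mem_filter au mem_drop_enum.
by rewrite inE => /predU1P[->//|/lt_v/ltnW].
Qed.

Definition available s P N u := (s <= u) && (u \notin P ++ N).

(** [inv_back] and [inv_next] anticipate [greedy_back] and [greedy_next] for every vertex that may
    still be appended. The last clause of [inv_N] keeps neglected vertices below every future
    end. *)
Record gp_inv S s P N : Prop := GpInv {
  inv_pos : 0 < size P;
  inv_head : nth s P 0 = s;
  inv_greedy : greedy (adj I) S (nth s P) (size P).-1;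
  inv_uniq : uniq (P ++ N);
  inv_ge : {in P ++ N, forall v, s <= v};
  inv_N : {in N, forall v, [/\ v \notin S, v < last s P &
    forall u, available s P N u -> v < u]};
  inv_back : forall u, available s P N u ->
    forall m, m < size P -> u < nth s P m -> adj I u (nth s P m);
  inv_next : forall u, available s P N u ->
    forall m, m.+1 < size P -> adj I (nth s P m) u -> nth s P m.+1 <= u }.

Lemma gp_inv_start S s : s \in S -> gp_inv S s [:: s] [::].
Proof.
move=> sS; split=> //=; first split=> //.
- by move=> [|k] [|m].
- by move=> [|m].
- by move=> m [].
- by move=> m [].
- by move=> v; rewrite inE => /eqP->.
- by move=> u /andP[le_su _] [|m] // _ /=; rewrite ltnNge le_su.
Qed.

Lemma nth_rcons_lt (x : 'I_n) P w k : k < size P ->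
  nth x (rcons P w) k = nth x P k.
Proof. by move=> ltk; rewrite nth_rcons ltk. Qed.

Lemma gp_inv_step S s P N P' N' :
    gp_inv S s P N -> gp_step I S (drop s (enum 'I_n)) s (P, N) = (P', N') ->
  gp_inv S s P' N' /\
  ((P', N') = (P, N) /\ (forall u, available s P N u -> ~~ adj I (last s P) u)
   \/ size P' + size N' = (size P + size N).+1).
Proof.
move=> inv; rewrite /gp_step.
case eqF: [seq _ <- _ | _] => [|v J].
  case=> <- <-; split=> //; left; split=> // u /andP[le_su uNPN];
    apply/negP => adj_u.
  suff : u \in [::] by []; rewrite -eqF mem_filter adj_u uNPN.
  by rewrite mem_drop_enum.
have [le_sv /andP[adj_v vPN] min_v] := head_filter_enum eqF.
have avail_v : available s P N v by rewrite /available le_sv.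
have {eqF}min_v u : available s P N u -> adj I (last s P) u -> v <= u.
  by move=> /andP[le_su uPN] adj_u; apply: min_v; rewrite ?adj_u.
have sizeP := inv_pos inv.
have last_lt : (size P).-1 < size P by rewrite prednK.
rewrite rltE; case: ifP => [/andP[vS lt_v]|no_neglect] [<- <-]; last first.
  have avail_sub u : available s (rcons P v) N u -> available s P N u /\ u <> v.
    by rewrite /available cat_rcons !(mem_cat, inE) !negb_or =>
      /and4P[-> -> /eqP ? ->].
  split; last by right; rewrite size_rcons addSn.
  split.
  - by rewrite size_rcons.
  - by rewrite nth_rcons_lt // (inv_head inv).
  - rewrite size_rcons /= -(prednK sizeP).
    have eqv : nth s (rcons P v) (size P).-1.+1 = v
      by rewrite prednK // nth_rcons ltnn eqxx.
    apply: (greedy_extend (inv_greedy inv));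
      rewrite ?eqv ?nth_last ?(inv_head inv) //.
    + by move=> k lek; rewrite nth_rcons_lt //; lia.
    + move=> k lek eqk; have ltk : k < size P by lia.
      by case/negP: vPN; rewrite mem_cat -eqk mem_nth.
    + by move=> k lek; apply: (inv_back inv) => //; lia.
    + by move=> k lek; apply: (inv_next inv) => //; lia.
    + move=> u lt_u newu; apply: min_v; rewrite /available mem_cat negb_or.
      have le_su : s <= u.
        by apply: leq_trans (ltnW lt_u); apply: (inv_ge inv);
          rewrite mem_cat -nth_last mem_nth.
      rewrite le_su /=; apply/andP; split.
        by apply/negP => /(nthP s)[k ltk eqk]; case: (newu k _ eqk);
          rewrite -ltnS prednK.
      by apply/negP => /(inv_N inv)[_ lt_u' _]; lia.
    + by move: no_neglect => /negbT; rewrite negb_and negbK => /orP[//|/negP].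
  - by rewrite cat_rcons -cat1s uniq_catCA /= vPN (inv_uniq inv).
  - move=> u; rewrite cat_rcons !(mem_cat, inE) => /or3P[uP|/eqP->//|uN];
    by apply: (inv_ge inv); rewrite mem_cat ?uP ?uN ?orbT.
  - move=> u /(inv_N inv)[uS lt_u min_u]; split=> //.
      by rewrite last_rcons min_u.
    by move=> x /avail_sub[/min_u].
  - move=> u /avail_sub[avail_u ne_uv] m; rewrite size_rcons ltnS leq_eqVlt.
    case/predU1P=> [->|ltm]; last by rewrite nth_rcons_lt //;
      apply: (inv_back inv).
    rewrite nth_rcons ltnn eqxx => lt_uv.
    (* As [v] is the smallest candidate, [u] is not adjacent to the old end, so by [inv_back] it
       lies above that end; the umbrella property then makes it adjacent to [v]. *)
    have Nadj : ~~ adj I (last s P) u by apply/negP => /(min_v u avail_u); lia.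
    apply: (adj_umbrella (u := last s P)) (ltnW lt_uv) adj_v.
    rewrite leqNgt; apply/negP => lt_u; case/negP: Nadj;
      rewrite adj_sym -nth_last.
    by apply: (inv_back inv); rewrite ?nth_last.
  - move=> u /avail_sub[avail_u ne_uv] m; rewrite size_rcons ltnS leq_eqVlt.
    case/predU1P=> [eqm|ltm]; last first.
      by rewrite !nth_rcons_lt //; [apply: (inv_next inv)|lia].
    rewrite nth_rcons_lt -?eqm // nth_rcons eqm ltnn eqxx.
    have -> : m = (size P).-1 by rewrite -eqm.
    by rewrite nth_last; apply: min_v.
have avail_sub u : available s P (v :: N) u -> available s P N u /\ u <> v.
  by rewrite /available !(mem_cat, inE) !negb_or => /and4P[-> -> /eqP ? ->].
split; last by right; rewrite /= addnS.
split; try by case: inv.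
- by rewrite -cat1s uniq_catCA /= vPN (inv_uniq inv).
- move=> u; rewrite !(mem_cat, inE) => /or3P[uP|/eqP->//|uN];
  by apply: (inv_ge inv); rewrite mem_cat ?uP ?uN ?orbT.
- move=> u; rewrite inE => /predU1P[->|/(inv_N inv)[uS lt_u min_u]]; split=> //.
    (* An available [x] below the end is a candidate by [inv_back], hence above the minimum [v]; any
       other is above the end, and so above [v]. *)
    move=> x /avail_sub[avail_x ne_xv].
    rewrite ltn_neqAle (contra_not_neq _ ne_xv) /=; last by move=> /val_inj.
    case: (leqP x (last s P)) => [|lt_x]; last by lia.
    rewrite leq_eqVlt => /predU1P[/val_inj eqx|lt_x].
      by move: avail_x; rewrite /available eqx mem_cat -nth_last mem_nth ?andbF.
    apply: min_v => //; rewrite adj_sym -nth_last.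
    by apply: (inv_back inv); rewrite ?nth_last.
  by move=> x /avail_sub[/min_u].
- by move=> u /avail_sub[avail_u _]; apply: (inv_back inv).
- by move=> u /avail_sub[avail_u _]; apply: (inv_next inv).
Qed.

End GreedyPath.

(** * Completed greedy runs and the covering of the Steiner set *)

Section SteinerCycle.
Variables (R : realType) (n : nat) (I : n.-tuple (cinterval R)).
Hypothesis I_sorted : sorted (fun i j => (rgt i <= rgt j)%R) I.
Implicit Types (s u v w z : 'I_n) (S : {set 'I_n}) (P Q N C : seq 'I_n).

Lemma gp_step_stuck S s P N :
  (forall u, available s P N u -> ~~ adj I (last s P) u) ->
  gp_step I S (drop s (enum 'I_n)) s (P, N) = (P, N).
Proof.
move=> stuck; rewrite /gp_step; case eqF: [seq _ <- _ | _] => [//|v J].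
have [le_sv /andP[adj_v vPN] _] := head_filter_enum eqF.
by have := stuck v; rewrite /available le_sv vPN adj_v => /(_ isT).
Qed.

Lemma gp_final S s : s \in S -> exists P N,
  [/\ gp I S (drop s (enum 'I_n)) = P, gp_inv I S s P N &
      forall u, available s P N u -> ~~ adj I (last s P) u].
Proof.
move=> sS; rewrite /gp {1}drop_enum; set J := drop s (enum 'I_n).
have [P [N [eqPN inv fin]]] : exists P N,
    [/\ iter (size J) (gp_step I S J s) ([:: s], [::]) = (P, N),
        gp_inv I S s P N &
        (forall u, available s P N u -> ~~ adj I (last s P) u) \/
        size P + size N = (size J).+1].
  elim: (size J) => [|k [P [N [eqPN inv fin]]]].
    by exists [:: s], [::]; split; [|apply: gp_inv_start|right].
  case: fin => [stuck|sizePN].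
    by exists P, N; split; [rewrite iterS eqPN gp_step_stuck| |left].
  case step: (gp_step I S J s (P, N)) => [P' N'].
  have [inv' fin'] := gp_inv_step I_sorted inv step.
  exists P', N'; split; rewrite ?iterS ?eqPN //.
  by case: fin' => [[[-> ->] stuck]|->]; [left|right; rewrite sizePN].
(* If the run never got stuck, [size J] steps would place [size J + 1] distinct vertices of [J] in
   [P] and [N]. *)
exists P, N; split; rewrite ?eqPN //; case: fin => // sizePN.
have : size (P ++ N) <= size J.
  apply: uniq_leq_size (inv_uniq inv) _ => v /(inv_ge inv).
  by rewrite mem_drop_enum.
by rewrite size_cat sizePN ltnn.
Qed.

(** The end of a stuck path has no exit, so [X1] is empty. The vertex [z] cannot be neglected, being
    in [S], and lies beyond the end, since otherwise [inv_back] would make it a candidate. *)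
Lemma gp_uncovered_no_cycle S s z C :
    s \in S -> z \in S -> s <= z -> z \notin gp I S (drop s (enum 'I_n)) ->
  ucycle (adj I) C -> ~ {subset S <= C}.
Proof.
move=> sS zS le_sz; have [P [N [-> inv stuck]]] := gp_final sS.
move=> zP; have sizeP := inv_pos inv.
have lastE : nth s P (size P).-1 = last s P by rewrite nth_last.
have avail_z : available s P N z.
  rewrite /available le_sz mem_cat negb_or zP; apply/negP => /(inv_N inv)[].
  by rewrite zS.
have [X [T [E obs]]] :=
  greedy_obstruction (@adj_sym R n I) (adj_umbrella I_sorted) (inv_greedy inv) (leqnn _).
apply: (prefix_obstruction_no_cycle (@adj_sym R n I) (adj_umbrella I_sorted)
  (X1 := [::]) obs zS) => //.
- rewrite lastE ltnNge leq_eqVlt; apply/negP => /predU1P[/val_inj eqz|lt_z].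
    by rewrite eqz -lastE mem_nth ?prednK in zP.
  case/negP: (stuck _ avail_z); rewrite adj_sym -lastE;
    apply: (inv_back inv) => //.
    by rewrite prednK.
  by rewrite lastE.
- move=> k le_k eqz; case/negP: zP; rewrite -eqz mem_nth //.
  by rewrite -ltnS prednK in le_k.
move=> y; rewrite lastE => lt_y newy; apply: contraTT => _; apply: stuck.
rewrite /available mem_cat negb_or; apply/and3P; split.
- apply: leq_trans (ltnW lt_y); apply: (inv_ge inv).
  by rewrite mem_cat -lastE mem_nth ?prednK.
- by apply/negP => /(nthP s)[k ltk /newy]; apply; rewrite -ltnS prednK.
- by apply/negP => /(inv_N inv)[_ lt_y' _]; lia.
Qed.

Lemma until_covered_take (T P : seq 'I_n) : {subset T <= P} ->
  exists k, [/\ until_covered T P = take k P, k <= size P,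
    {subset T <= take k P} & forall j, j < k -> ~ {subset T <= take j P}].
Proof.
move=> TP; pose a k := all (mem (take k P)) T.
pose k := find a (iota 0 (size P)); exists k.
have le_k : k <= size P by have := find_size a (iota 0 (size P));
  rewrite size_iota.
split=> //.
  (* If no proper prefix covers [T], [find] returns [size P] and the prefix is all of [P]. *)
  case: (ltnP k (size P)) => [lt_k|ge_k]; last by rewrite take_oversize.
  have /(nth_find 0) : has a (iota 0 (size P)) by rewrite has_find size_iota.
  by rewrite nth_iota // => /allP.
move=> j lt_jk /allP; have := before_find 0 lt_jk.
by rewrite nth_iota ?add0n /a => [->|]; last exact: leq_trans lt_jk le_k.
Qed.

Lemma until_covered_sub (T P : seq 'I_n) : {subset until_covered T P <= P}.
Proof. by move=> u /mem_take. Qed.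

Lemma uncovered_nil S Ps : uncovered S Ps = [::] -> {subset S <= flatten Ps}.
Proof.
move=> eq0 u uS; apply: contraT => uPs.
suff : u \in [::] by [].
by rewrite -eq0 mem_filter uS uPs mem_enum.
Qed.

Lemma uncovered_cons S v T : uncovered S [::] = v :: T ->
  v \in S /\ forall z, z \in S -> v <= z.
Proof.
rewrite /uncovered => eqT; have n_gt0 : 0 < n by case: (n) v {eqT T} => [[]|].
have eqT' : [seq u <- drop (Ordinal n_gt0) (enum 'I_n) | (u \in S) && (u \notin [::])] = v :: T.
  by rewrite drop0.
have [_ /andP[vS _] min_v] := head_filter_enum eqT'.
by split=> // z zS; apply: min_v; rewrite // zS.
Qed.

Lemma uncovered0 S u : (u \in uncovered S [::]) = (u \in S).
Proof. by rewrite mem_filter mem_enum !andbT. Qed.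

Lemma size_iterated_gp_iter S k Ps :
  size Ps <= size (iter k (iterated_gp_step I S) Ps).
Proof.
elim: k => //= k /leq_trans; apply; rewrite /iterated_gp_step.
by case: uncovered => // v T; rewrite size_rcons.
Qed.

(** * The first path of the iterated procedure *)

Section FirstPath.
Variables (S : {set 'I_n}) (s : 'I_n) (T : seq 'I_n).
Hypothesis eqT : uncovered S [::] = s :: T.

Let P1 := until_covered (s :: T) (gp I S (drop s (enum 'I_n))).

Lemma iterated_gp_covered : {subset S <= P1} -> iterated_gp I S = [:: P1].
Proof.
move=> cov; rewrite /iterated_gp.
have n_gt0 : 0 < n by case: (n) s => [[]|].
have iterE k Ps : 0 < k ->
    iter k (iterated_gp_step I S) Ps =
    iter k.-1 (iterated_gp_step I S) (iterated_gp_step I S Ps).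
  by case: k => // k _; rewrite iterSr.
rewrite iterE // [iterated_gp_step I S [::]]/iterated_gp_step eqT iter_fix //.
rewrite /iterated_gp_step; case eqU: uncovered => [//|v U].
have : v \in uncovered S [:: P1] by rewrite eqU mem_head.
by rewrite mem_filter /= cats0 => /andP[/andP[/cov->]].
Qed.

Lemma iterated_gp_uncovered : ~ {subset S <= P1} -> 1 < size (iterated_gp I S).
Proof.
move=> not_cov; have [sS min_s] := uncovered_cons eqT.
have [n_le1|n_gt1] := leqP n 1.
  (* A second path needs a second round; with at most one vertex there is none, but then the first
     path covers [S]. *)
  case: not_cov => z zS.
  have TS : {subset s :: T <= gp I S (drop s (enum 'I_n))}.
    move=> u _; have [P [N [-> inv _]]] := gp_final sS.
    have -> : u = s by apply/val_inj => /=; have := ltn_ord u;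
      have := ltn_ord s; lia.
    by rewrite -[X in X \in _](inv_head inv) mem_nth ?(inv_pos inv).
  have [k [eqk _ cov _]] := until_covered_take TS.
  by rewrite /P1 eqk; apply: cov; rewrite -eqT uncovered0.
have iterE k Ps : 1 < k ->
    iter k (iterated_gp_step I S) Ps =
    iter k.-2 (iterated_gp_step I S)
      (iterated_gp_step I S (iterated_gp_step I S Ps)).
  by case: k => [|[|k]] // _; rewrite !iterSr.
rewrite /iterated_gp iterE //; apply: leq_trans (size_iterated_gp_iter _ _ _).
rewrite [iterated_gp_step I S [::]]/iterated_gp_step eqT -/P1 /iterated_gp_step.
case eqU: (uncovered S (rcons [::] P1)) => [|v U //].
by case: not_cov; have := uncovered_nil eqU; rewrite /= cats0.
Qed.

(** Truncation loses nothing of [S], so the full greedy path misses some [z] in [S], and [s <= z]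
    because [s] is the minimum of [S]. *)
Lemma first_path_no_cycle C :
  ~ {subset S <= P1} -> ucycle (adj I) C -> ~ {subset S <= C}.
Proof.
move=> not_cov cycC SC; have [sS min_s] := uncovered_cons eqT.
have [/allP cov|/allPn[z]] :=
  boolP (all [in gp I S (drop s (enum 'I_n))] (s :: T)).
  apply: not_cov => z zS; have [k [eqk _ covk _]] := until_covered_take cov.
  by rewrite /P1 eqk; apply: covk; rewrite -eqT uncovered0.
rewrite -eqT uncovered0 => zS zP.
exact: gp_uncovered_no_cycle sS zS (min_s z zS) zP cycC SC.
Qed.

Lemma first_path_greedy : {subset S <= P1} ->
  [/\ greedy (adj I) S (nth s P1) (size P1).-1, uniq P1 & last s P1 \in S].
Proof.
move=> cov; have [sS _] := uncovered_cons eqT; rewrite /P1 in cov *.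
have [P [N [eqP inv _]]] := gp_final sS; rewrite eqP in cov *.
have TS : {subset s :: T <= P}.
  by move=> u; rewrite -eqT uncovered0 => /cov/until_covered_sub.
have [k [eqk le_k covk mink]] := until_covered_take TS; rewrite eqk in cov *.
have k_gt0 : 0 < k.
  by case: k covk {eqk le_k mink cov} => // /(_ s);
    rewrite take0 mem_head => /(_ isT).
have sizek : size (take k P) = k by rewrite size_takel.
rewrite sizek; split.
- apply: (greedy_take (inv_greedy inv)); first by lia.
  by move=> j le_j; rewrite nth_take //; lia.
- by apply: take_uniq; have := inv_uniq inv; rewrite cat_uniq => /and3P[].
(* If the last vertex were outside [S], the prefix without it would already cover [S]. *)
apply: contraT => lastS; case: (mink k.-1); first by lia.
move=> u uT; have := covk u uT.
have lt_k1 : k.-1 < size P by lia.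
rewrite -{1}(prednK k_gt0) (take_nth s) // mem_rcons inE => /predU1P[equ|//].
case/negP: lastS; rewrite -nth_last sizek nth_take ?prednK //.
by rewrite -equ -uncovered0 eqT.
Qed.

End FirstPath.

(** * Distributing the path over two paths *)

Section Split.
Variables (p1 p2 : 'I_n) (L : seq 'I_n).
Hypothesis L_uniq : uniq L.
Hypothesis L_adj :
  forall k, k.+1 < size L -> adj I (nth p1 L k) (nth p1 L k.+1).

(* After d intervals of L have been distributed, one of the two paths ends with
   the last of them, the other one with an earlier interval i that is adjacent
   to none of those distributed since, apart from its successor in L. *)
Definition split_inv d Rs Qs :=
  [/\ perm_eq ((p1 :: Rs) ++ p2 :: Qs) (take d L), path (adj I) p1 Rs,
      path (adj I) p2 Qs &
      exists i, [/\ i.+1 < d,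
        forall k, i.+1 < k -> k < d -> ~~ adj I (nth p1 L k) (nth p1 L i) &
        last p1 Rs = nth p1 L i /\ last p2 Qs = nth p1 L d.-1 \/
        last p2 Qs = nth p1 L i /\ last p1 Rs = nth p1 L d.-1]].

(** If the next interval meets the stalled end, it is appended there and the other end becomes the
    stalled one, at index [d.-1]; otherwise [i] is kept and the interval is one more
    non-neighbour. *)
Lemma split_pathP d Rs Qs : d <= size L -> split_inv d Rs Qs ->
  exists Rs' Qs',
    split_path I p1 p2 (nth p1 L d.-1) (drop d L) (p1 :: Rs) (p2 :: Qs) =
      (p1 :: Rs', p2 :: Qs') /\ split_inv (size L) Rs' Qs'.
Proof.
move eqm : (size L - d) => m;
  elim: m d Rs Qs eqm => [|m IHm] d Rs Qs eqm le_d inv.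
  have eqd : d = size L by lia.
  by rewrite eqd in inv *; exists Rs, Qs; rewrite drop_size.
have lt_d : d < size L by lia.
case: (inv) => perm pathR pathQ [i [lt_id stalled ends]].
have [eqm' d_gt0 lt_i] : [/\ size L - d.+1 = m, 0 < d & i < d.-1] by split; lia.
have prev_adj : adj I (nth p1 L d.-1) (nth p1 L d).
  by have := @L_adj d.-1; rewrite prednK; [apply|lia].
have toR : adj I (last p1 Rs) (nth p1 L d) ->
  perm_eq ((p1 :: rcons Rs (nth p1 L d)) ++ p2 :: Qs) (take d.+1 L) /\
  path (adj I) p1 (rcons Rs (nth p1 L d)).
  rewrite rcons_path pathR => ->; split=> //.
  rewrite (take_nth p1) // -rcons_cons cat_rcons perm_sym perm_rcons perm_sym.
  by rewrite -[nth p1 L d :: p2 :: Qs]cat1s perm_catCA perm_cons.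
have toQ : adj I (last p2 Qs) (nth p1 L d) ->
  perm_eq ((p1 :: Rs) ++ p2 :: rcons Qs (nth p1 L d)) (take d.+1 L) /\
  path (adj I) p2 (rcons Qs (nth p1 L d)).
  rewrite rcons_path pathQ => ->; split=> //.
  by rewrite (take_nth p1) // -rcons_cons -rcons_cat -!cats1 perm_cat2r.
rewrite (drop_nth p1) //=; case: ends => [[eqR eqQ]|[eqQ eqR]].
- rewrite eqQ eqxx eqR; case: ifP => adj_d.
    have [|perm' pathR'] := toR; first by rewrite eqR adj_sym.
    apply: (IHm d.+1 (rcons Rs (nth p1 L d)) Qs);
      [exact: eqm'|exact: lt_d|split=> //].
    exists d.-1; split; [by rewrite prednK|by rewrite prednK // => k lt_dk;
      rewrite ltnS leqNgt lt_dk|right; split=> //].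
    by rewrite last_rcons.
  have [|perm' pathQ'] := toQ; first by rewrite eqQ.
  apply: (IHm d.+1 Rs (rcons Qs (nth p1 L d)));
    [exact: eqm'|exact: lt_d|split=> //].
  exists i; split; [exact: ltnW| |left; split=> //; by rewrite last_rcons].
  move=> k lt_ik; rewrite ltnS leq_eqVlt => /predU1P[->|]; last exact: stalled.
  by rewrite adj_d.
(* The ends have different indices [i < d.-1], so distinctness of [L] decides the test. *)
- have -> : last p2 Qs == nth p1 L d.-1 = false.
    by rewrite eqQ nth_uniq // ?(ltn_eqF lt_i) // (ltn_trans _ lt_d) // ?prednK // ltnW.
  rewrite eqQ; case: ifP => adj_d.
    have [|perm' pathQ'] := toQ; first by rewrite eqQ adj_sym.
    apply: (IHm d.+1 Rs (rcons Qs (nth p1 L d)));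
      [exact: eqm'|exact: lt_d|split=> //].
    exists d.-1; split; [by rewrite prednK|by rewrite prednK // => k lt_dk;
      rewrite ltnS leqNgt lt_dk|left; split=> //].
    by rewrite last_rcons.
  have [|perm' pathR'] := toR; first by rewrite eqR.
  apply: (IHm d.+1 (rcons Rs (nth p1 L d)) Qs);
    [exact: eqm'|exact: lt_d|split=> //].
  exists i; split; [exact: ltnW| |right; split=> //; by rewrite last_rcons].
  move=> k lt_ik; rewrite ltnS leq_eqVlt => /predU1P[->|]; last exact: stalled.
  by rewrite adj_d.
Qed.

End Split.

(** * Closing the cycle and correctness of the algorithm *)

Lemma path_rev_rcons x p y z : path (adj I) x p ->
  path (adj I) y (rcons (rev (x :: p)) z) = adj I y (last x p) && adj I x z.
Proof.
move=> xp; rewrite lastI rev_rcons rcons_path /=.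
have -> : last (last x p) (rev (belast x p)) = x.
  by rewrite -[LHS]/(last x (last x p :: _)) -rev_rcons -lastI rev_cons last_rcons.
rewrite rev_path (eq_path (e' := adj I)) ?xp ?andbT //.
by move=> u v; rewrite adj_sym.
Qed.

(** The list [v] is empty or holds the closing interval, which treats both outputs at once. *)
Lemma split_cycle p1 p2 Rs Qs (v : seq 'I_n) :
    path (adj I) p1 Rs -> path (adj I) p2 Qs -> adj I p1 p2 ->
    (if v is [:: w] then adj I (last p2 Qs) w && adj I w (last p1 Rs)
     else (v == [::]) && adj I (last p2 Qs) (last p1 Rs)) ->
  cycle (adj I) ((p2 :: Qs) ++ v ++ rev (p1 :: Rs)).
Proof.
move=> pathR pathQ p12; rewrite /= rcons_cat cat_path pathQ /=.
case: v => [|w [|]] //=; last move=> /andP[-> wR] /=.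
  by move=> QR; rewrite path_rev_rcons // QR p12.
by rewrite path_rev_rcons // wR p12.
Qed.

Lemma steiner_cycle_algorithm_spec S :
  if steiner_cycle_algorithm I S is Some C then is_steiner_cycle I S C
  else forall C, ~ is_steiner_cycle I S C.
Proof.
rewrite /steiner_cycle_algorithm.
case eqT: (uncovered S [::]) => [|s T].
  have -> : iterated_gp I S = [::].
    by rewrite /iterated_gp iter_fix // /iterated_gp_step eqT.
  by split=> //; apply: uncovered_nil eqT.
set P1 := until_covered (s :: T) (gp I S (drop s (enum 'I_n))).
have [/subsetP cov|not_cov] := boolP (S \subset P1); last first.
  have {}not_cov : ~ {subset S <= P1} by move/subsetP; apply/negP.
  have := iterated_gp_uncovered eqT not_cov.
  case: (iterated_gp I S) => [|P [|P' Ps]] // _ C [cycC SC].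
  exact: first_path_no_cycle eqT _ not_cov cycC SC.
rewrite (iterated_gp_covered eqT cov).
have [] := first_path_greedy eqT cov; rewrite -/P1.
move: P1 cov => P cov gr uniqP lastS.
case: P => [|p1 [|p2 L]] in cov gr uniqP lastS *.
- by split.
- by split=> //; rewrite /ucycle /= adj_refl.
set P := p1 :: p2 :: L in cov gr uniqP lastS *.
have {}gr : greedy (adj I) S (nth p1 P) (size P).-1.
  by apply: (greedy_take gr) => // k le_k; apply: set_nth_default;
    rewrite /= ltnS.
have {}lastS : nth p1 P (size P).-1 \in S by rewrite nth_last.
have P_adj k : k.+1 < size P -> adj I (nth p1 P k) (nth p1 P k.+1).
  by move=> lt_k; apply: (greedy_adj gr); rewrite -ltnS prednK.
have start : split_inv p1 p2 P 2 [::] [::].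
  split=> //; first by rewrite /= take0.
  by exists 0; split=> // [k|]; [lia|left].
have [Rs [Qs [eqRQ [perm pathR pathQ ends]]]] := 
  split_pathP uniqP P_adj (isT : 2 <= size P) start.
have eqd : drop 2 P = L by rewrite /= drop0.
rewrite eqd /= in eqRQ; rewrite eqRQ {eqd eqRQ} /=.
have p12 : adj I p1 p2 by apply: (P_adj 0).
rewrite take_size in perm.
have permP V : perm_eq ((p2 :: Qs) ++ V ++ rev (p1 :: Rs)) (V ++ P).
  rewrite perm_catCA perm_cat2l; apply: perm_trans perm.
  by rewrite perm_catC perm_cat2r perm_rev.
case: ifP => [adjQR|nadj].
  have := permP [::]; rewrite cat0s => permP0; split.
    rewrite /ucycle (perm_uniq permP0) uniqP andbT.
    by apply: (split_cycle (v := [::])).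
  by move=> u /cov; rewrite (perm_mem permP0).
case: pickP => [v /and4P[vP _ vQ vR]|none].
  have permPv := permP [:: v]; split.
    apply/andP; split; last by rewrite (perm_uniq permPv); apply/andP.
    by apply: (split_cycle (v := [:: v])) => //; rewrite adj_sym vQ.
  by move=> u /cov uP; rewrite (perm_mem permPv) inE uP orbT.
move=> C [cycC SC]; case: ends => i [lt_i stalled ends].
have Nends : ~~ adj I (nth p1 P (size P).-1) (nth p1 P i).
  by case: ends nadj => [[<- <-]|[<- <-]]; rewrite 1?adj_sym => ->.
apply: (greedy_stalled_no_cycle (@adj_sym R n I) (adj_umbrella I_sorted) (i :=
  i) gr lastS _ _ _ cycC SC).
(* The invariant only gives [i.+1 <= l] for the last index [l]; equality would make the two ends
   consecutive, hence adjacent. *)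
- rewrite ltn_neqAle -ltnS prednK // lt_i andbT; apply: contraNneq Nends => <-.
  by rewrite adj_sym P_adj.
- by move=> k lt_ik le_k; apply: stalled; rewrite // -ltnS prednK.
move=> v lt_v vi; apply/negP => vl.
(* A common neighbour beyond the whole path would have been found by the final search. *)
have lt_P : {in P, forall q : 'I_n, q < v}.
  by move=> q /(nthP p1)[k lt_k <-]; apply: lt_v; rewrite -ltnS prednK.
have vP : v \notin P by apply/negP => /lt_P; rewrite ltnn.
have all_lt : all (fun p => rlt I p v) P by apply/allP => q /lt_P; rewrite rltE.
have : [&& v \notin P, all (fun p => rlt I p v) P, adj I v (last p2 Qs)
         & adj I v (last p1 Rs)] = false := none v.
by rewrite vP all_lt; case: ends => -[-> ->]; rewrite vi vl.
Qed.

End SteinerCycle.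

Local Open Scope ring_scope.

Theorem theorem2 (R : realType) (n : nat) (I : n.-tuple (cinterval R))
    (S : {set 'I_n}) (I_sorted : sorted (fun i j => rgt i <= rgt j) I) :
  (isSome (steiner_cycle_algorithm I S) <->
     exists C : seq 'I_n, is_steiner_cycle I S C) /\
  (forall C : seq 'I_n,
     steiner_cycle_algorithm I S = Some C -> is_steiner_cycle I S C).
Proof.
have := steiner_cycle_algorithm_spec I_sorted S.
case: steiner_cycle_algorithm => [C cycC|no_cycle]; last first.
  by split=> //; split=> // -[C /no_cycle].
by split=> [|_ [<-]//]; split=> // _; exists C.
Qed.
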